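(* Let $N\ge1$ and let $X=\{X_t;\ t\in\mathbf{R}^N_+\}$ be a continuous real-valued stochastic process such that, for every $t_0\in\mathbf{R}^N_+$, almost surely the graph $\{(s',\boldsymbol{\sigma}_{t_0}(s')) : s'<0\}$ meets the region $D$. Assume that there exist a constant $\eta>0$ and a positive function $\mu:\mathbf{R}^N_+\to(0,\infty)$ which admits a positive lower bound, such that for all $t_0\in\mathbf{R}^N_+$ there exist $C_0>0$ and $\rho_0>0$ with $$\forall t,u\in B(t_0,\rho_0);\quad E\left[|X_t-X_u|^{\eta}\right]\le C_0\,\|t-u\|^{N+\mu(t_0)}.$$ Then, almost surely, $$\forall t_0\in\mathbf{R}^N_+;\quad \widetilde{\boldsymbol{\alpha}}(t_0)\ge\liminf_{u\to t_0}\frac{\mu(u)}{\eta},$$ and, as a consequence, almost surely $$\forall t_0\in\mathbf{R}^N_+,\ \forall s'<0;\quad \boldsymbol{\sigma}_{t_0}(s')\ge s'+\liminf_{u\to t_0}\frac{\mu(u)}{\eta}.$$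
   Context: $\mathbf{R}^N_+=[0,\infty)^N$ with norm $\|\cdot\|$; $B(t_0,\rho)$ is the ball of centre $t_0$ and radius $\rho$ in $\mathbf{R}^N_+$; suprema of quotients with $\|t-u\|$ in the denominator are over $t\ne u$. The $2$-microlocal frontier of $X$ at $t_0$ is the random function defined for $s'\in(-\infty,0)$ by $$\boldsymbol{\sigma}_{t_0}(s')=\sup\Big\{\sigma:\ \limsup_{\rho\to0}\ \sup_{t,u\in B(t_0,\rho)}\frac{|X_t-X_u|}{\|t-u\|^{\sigma}\rho^{-s'}}<\infty\Big\}.$$ The (random) local Hölder exponent of $X$ at $t_0$ is $$\widetilde{\boldsymbol{\alpha}}(t_0)=\sup\Big\{\alpha:\ \limsup_{\rho\to0}\ \sup_{t,u\in B(t_0,\rho)}\frac{|X_t-X_u|}{\|t-u\|^{\alpha}}<\infty\Big\}.$$ $D=\{(s',\sigma): -1<s'<0,\ 0<\sigma<1+s'\}$. The notation $\liminf_{u\to t_0}f(u)$ means $\lim_{r\to0}\inf_{u\in B(t_0,r)}f(u)$, the point $u=t_0$ being included. *)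

(* Defs.v *)
From mathcomp Require Import all_boot all_order all_algebra.
From mathcomp Require Import all_classical all_reals all_analysis.

Set Implicit Arguments.
Unset Strict Implicit.
Unset Printing Implicit Defensive.

Import Order.TTheory GRing.Theory Num.Theory.
Import numFieldNormedType.Exports.

Local Open Scope classical_set_scope.
Local Open Scope ring_scope.

Definition orthant (R : realType) (N : nat) : set 'rV[R]_N :=
  [set t | forall i, 0 <= t ord0 i].

Record is_norm (R : realType) (N : nat) (nrm : 'rV[R]_N -> R) : Prop := {
  is_norm_triangle : forall x y, nrm (x + y) <= nrm x + nrm y ;
  is_norm_scale : forall (a : R) x, nrm (a *: x) = `|a| * nrm x ;
  is_norm_definite : forall x, nrm x = 0 -> x = 0 }.

Definition orthant_ball (R : realType) (N : nat) (nrm : 'rV[R]_N -> R)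
    (t0 : 'rV[R]_N) (rho : R) : set 'rV[R]_N :=
  [set t | orthant t /\ nrm (t - t0) < rho].

Definition offdiag (R : realType) (N : nat) (A : set 'rV[R]_N) :
    set ('rV[R]_N * 'rV[R]_N) :=
  [set p | [/\ A p.1, A p.2 & p.1 != p.2]].

(* Below, x is one sample path of the process; only its values on the orthant
   are used. *)

Definition frontier_2ml (R : realType) (N : nat) (nrm : 'rV[R]_N -> R)
    (x : 'rV[R]_N -> R) (t0 : 'rV[R]_N) (s' : R) : \bar R :=
  ereal_sup [set sigma%:E | sigma in [set sigma : R |
    (limf_esup (fun rho : R =>
       ereal_sup [set (`|x p.1 - x p.2| /
                       (nrm (p.1 - p.2) `^ sigma * rho `^ (- s')))%:E
                 | p in offdiag (orthant_ball nrm t0 rho)])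
     0^'+ < +oo)%E]].

Definition local_holder_exponent (R : realType) (N : nat)
    (nrm : 'rV[R]_N -> R) (x : 'rV[R]_N -> R) (t0 : 'rV[R]_N) : \bar R :=
  ereal_sup [set alpha%:E | alpha in [set alpha : R |
    (limf_esup (fun rho : R =>
       ereal_sup [set (`|x p.1 - x p.2| / nrm (p.1 - p.2) `^ alpha)%:E
                 | p in offdiag (orthant_ball nrm t0 rho)])
     0^'+ < +oo)%E]].

Definition region_D (R : realType) : set (R * R) :=
  [set p | -1 < p.1 < 0 /\ 0 < p.2 < 1 + p.1].

Definition graph_meets_D (R : realType) (N : nat) (nrm : 'rV[R]_N -> R)
    (x : 'rV[R]_N -> R) (t0 : 'rV[R]_N) : Prop :=
  exists s' sigma : R, [/\ s' < 0,
    frontier_2ml nrm x t0 s' = sigma%:E & region_D (s', sigma)].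

(* The centre t0 is included in the infimum, unlike in lime_inf. *)
Definition liminf_at (R : realType) (N : nat) (nrm : 'rV[R]_N -> R)
    (f : 'rV[R]_N -> R) (t0 : 'rV[R]_N) : \bar R :=
  lim (ereal_inf [set (f u)%:E | u in orthant_ball nrm t0 r] @[r --> 0^'+]).

(* Main.v *)
Require Import Defs.
From mathcomp Require Import all_boot all_order all_algebra.
From mathcomp Require Import all_classical all_reals all_analysis.
From mathcomp Require Import measurable_realfun ring lra zify.

(** The moment bound at a single point [t0] is a Kolmogorov criterion on a whole
ball around [t0], hence on a dyadic cube containing [t0] in its relative
interior.  There are countably many pairs of a dyadic cube and a rational
exponent [alpha], and for each pair such that the criterion holds on the cube
with some exponent [a > alpha * eta], chaining gives Hoelder continuity of order
[alpha] on the cube outside a null set.  Outside the union of these null sets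
the local Hoelder exponent at every [t0] is therefore at least [mu t0 / eta],
which dominates the liminf because the centre is included in the infimum.  The
bound on the frontier follows from [nrm (t - u) <= 2 rho] on the ball of radius
[rho]. *)

Import Order.TTheory GRing.Theory Num.Theory.
Import numFieldNormedType.Exports.

Set Implicit Arguments.
Unset Strict Implicit.
Unset Printing Implicit Defensive.

Local Open Scope classical_set_scope.
Local Open Scope ring_scope.

(** * Equivalence of an arbitrary norm with the sup norm *)

Section NormEquivalence.
Variables (R : realType) (N : nat) (nrm : 'rV[R]_N -> R).
Hypothesis hnrm : is_norm nrm.

Lemma is_norm0 : nrm 0 = 0.
Proof. by rewrite -(scale0r 0) (is_norm_scale hnrm) normr0 mul0r. Qed.

Lemma is_normN x : nrm (- x) = nrm x.
Proof. by rewrite -scaleN1r (is_norm_scale hnrm) normrN1 mul1r. Qed.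

Lemma is_norm_ge0 x : 0 <= nrm x.
Proof.
have := is_norm_triangle hnrm x (- x).
by rewrite subrr is_norm0 is_normN; lra.
Qed.

Lemma is_norm_gt0 x : x != 0 -> 0 < nrm x.
Proof.
move=> x0; rewrite lt_neqAle is_norm_ge0 andbT eq_sym.
by apply: contra_neq x0; exact: is_norm_definite.
Qed.

Lemma coord_le_mx_norm (x : 'rV[R]_N) i : `|x ord0 i| <= `|x|.
Proof.
rewrite [leRHS]/Num.norm /= mx_normrE; apply/bigmax_geP; right => /=.
by exists (ord0, i).
Qed.

Lemma mx_norm_le_coord (x : 'rV[R]_N) (e : R) : 0 <= e ->
  (forall i, `|x ord0 i| <= e) -> `|x| <= e.
Proof.
move=> e0 xe; rewrite [leLHS]/Num.norm /= mx_normrE; apply/bigmax_leP.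
by split=> // -[i j] _ /=; rewrite (ord1 i).
Qed.

Lemma is_norm_sum (I : Type) (r : seq I) (F : I -> 'rV[R]_N) :
  nrm (\sum_(i <- r) F i) <= \sum_(i <- r) nrm (F i).
Proof.
elim/big_ind2 : _ => //; first by rewrite is_norm0.
move=> x1 y1 x2 y2 h1 h2; apply: le_trans (is_norm_triangle hnrm _ _) _.
exact: lerD.
Qed.

Lemma is_norm_le_mx_norm : exists2 K : R, 0 < K & forall x, nrm x <= K * `|x|.
Proof.
(* The summand [1] keeps the constant positive when [N = 0], where the sum over basis vectors is
   empty. *)
exists (1 + \sum_(i < N) nrm (delta_mx 0 i)).
  by rewrite ltr_pwDl // sumr_ge0// => i _; exact: is_norm_ge0.
move=> x; rewrite mulrDl mul1r.
apply: (@le_trans _ _ ((\sum_(i < N) nrm (delta_mx 0 i)) * `|x|)); last first.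
  by rewrite lerDr.
rewrite {1}(row_sum_delta x); apply: le_trans (is_norm_sum _ _) _.
rewrite mulr_suml; apply: ler_sum => i _.
rewrite (is_norm_scale hnrm) mulrC ler_wpM2l ?is_norm_ge0//.
exact: coord_le_mx_norm.
Qed.

Lemma is_norm_lipschitz x y : `|nrm x - nrm y| <= nrm (x - y).
Proof.
rewrite ler_norml.
have := is_norm_triangle hnrm (x - y) y; rewrite subrK.
have := is_norm_triangle hnrm (y - x) x; rewrite subrK -(opprB x) is_normN.
by lra.
Qed.

Lemma is_norm_continuous : continuous nrm.
Proof.
have [K K0 hK] := is_norm_le_mx_norm.
move=> x; apply/(@cvgrPdist_lt _ _ _ (nbhs x) (nbhs_filter x)) => e e0.
apply/nbhs_ballP.
exists (e / K); first by rewrite /= divr_gt0.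
move=> y; rewrite -ball_normE /= ltr_pdivlMr// mulrC => xy.
by apply: le_lt_trans (is_norm_lipschitz _ _) _; exact: le_lt_trans xy.
Qed.

(* The minimum of [nrm] on the compact unit sphere of the sup norm is positive. *)
Lemma mx_norm_le_is_norm : exists2 K : R, 0 < K & forall x, `|x| <= K * nrm x.
Proof.
pose S := [set x : 'rV[R]_N | `|x| = 1].
(* If the sphere is empty, normalizing shows that every vector is zero, and any constant will do. *)
have [S0|nS0] := pselect (S !=set0); last first.
  exists 1 => // x; rewrite mul1r.
  have [->|x0] := eqVneq x 0; first by rewrite normr0 is_norm_ge0.
  exfalso; apply: nS0; exists (`|x|^-1 *: x).
  by rewrite /S/= normrZ normfV normr_id mulVf// normr_eq0.
have Scpt : compact S.
  apply: bounded_closed_compact.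
    by exists 1; split=> [|M M1 x /= ->]; [exact: num_real|exact: ltW].
  have -> : S = (fun x : 'rV[R]_N => `|x|) @^-1` [set 1] by [].
  apply: preimage_closed; last exact: closed_eq.
  by move=> x _; exact: norm_continuous.
have [c cS cmin] :=
  EVT_min_rV S0 Scpt (continuous_subspaceT is_norm_continuous).
have c1 : `|c| = 1 by move: cS; rewrite inE.
have c0 : 0 < nrm c by apply: is_norm_gt0; rewrite -normr_eq0 c1 oner_eq0.
exists (nrm c)^-1; first by rewrite invr_gt0.
move=> x; have [->|x0] := eqVneq x 0; first by rewrite normr0 is_norm0 mulr0.
have nx : 0 < `|x| by rewrite normr_gt0.
rewrite mulrC ler_pdivlMr// mulrC -ler_pdivlMr//.
have : `|x|^-1 *: x \in S.
  by rewrite inE /S/= normrZ normfV normr_id mulVf// normr_eq0.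
by move=> /cmin; rewrite (is_norm_scale hnrm) normfV normr_id mulrC.
Qed.

End NormEquivalence.

Lemma powR_lt1 (R : realType) (x r : R) : 1 < x -> r < 0 -> x `^ r < 1.
Proof.
move=> x1 r0; rewrite /powR gt_eqF ?(lt_trans ltr01)//.
by rewrite expR_lt1 nmulr_rlt0// ln_gt0.
Qed.

(** * Deterministic chaining along dyadic points of the unit cube *)

Section DyadicChaining.
Variables (R : realType) (N : nat).

Definition dyadic_point (n : nat) (j : 'I_N -> nat) : 'rV[R]_N :=
  \row_i ((j i)%:R / 2 ^+ n).

(** On nonnegative coordinates [truncn] is the integer part, so these indices give the lower corner
    of the half-open dyadic cell of side 2^-n containing [x]. *)
Definition dyadic_floor (n : nat) (x : 'rV[R]_N) : 'I_N -> nat :=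
  fun i => Num.truncn (x ord0 i * 2 ^+ n).

(** The upper faces are left out so that floor indices at level [n] stay below 2^n, the range in
    which increments are controlled. *)
Definition unit_cube : set 'rV[R]_N := [set x | forall i, 0 <= x ord0 i < 1].

Let pow2_gt0 n : 0 < 2 ^+ n :> R.
Proof. by rewrite exprn_gt0. Qed.

Lemma dyadic_floorP n x i : unit_cube x ->
  (dyadic_floor n x i)%:R <= x ord0 i * 2 ^+ n < (dyadic_floor n x i).+1%:R.
Proof.
by move=> /(_ i)/andP[x0 _]; apply: truncn_itv; rewrite mulr_ge0// ltW.
Qed.

Lemma dyadic_floor_lt n x i : unit_cube x -> (dyadic_floor n x i < 2 ^ n)%N.
Proof.
move=> xU; have /andP[x0 x1] := xU i.
rewrite truncn_lt_nat ?mulr_ge0// ?ltW//.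
by rewrite natrX -[ltRHS]mul1r ltr_pM2r.
Qed.

(** Doubling the inequalities that define the index p at level [n] leaves only 2p and 2p + 1 for the
    next level. *)
Lemma dyadic_floor_succ n x i : unit_cube x ->
  exists b : bool, dyadic_floor n.+1 x i = ((dyadic_floor n x i).*2 + b)%N.
Proof.
move=> xU; have := dyadic_floorP n.+1 i xU; have := dyadic_floorP n i xU.
set p := dyadic_floor n x i; set q := dyadic_floor n.+1 x i.
rewrite exprS => /andP[p1 p2] /andP[q1 q2].
have h1 : (p.*2 < q.+1)%N.
  by rewrite -(ltr_nat R) -mul2n natrM; apply: le_lt_trans q2; nra.
have h2 : (q < p.+1.*2)%N.
  by rewrite -(ltr_nat R) -mul2n natrM; apply: le_lt_trans q1 _; nra.
by exists (q != p.*2); lia.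
Qed.

Lemma dyadic_floor_near n x y i : unit_cube x -> unit_cube y ->
  `|x ord0 i - y ord0 i| <= (2 ^+ n)^-1 ->
  (dyadic_floor n x i <= (dyadic_floor n y i).+1)%N.
Proof.
move=> xU yU; have := dyadic_floorP n i xU; have := dyadic_floorP n i yU.
set p := dyadic_floor n x i; set q := dyadic_floor n y i.
move=> /andP[q1 q2] /andP[p1 p2] xy.
have xy1 : `|x ord0 i - y ord0 i| * 2 ^+ n <= 1.
  by rewrite -ler_pdivlMr ?div1r.
rewrite -ltnS -(ltr_nat R) [ltRHS](_ : _ = q.+1%:R + 1); last by rewrite natr1.
apply: le_lt_trans p1 _.
apply: (@le_lt_trans _ _ (y ord0 i * 2 ^+ n + 1)); last by rewrite ltrD2r.
rewrite -lerBlDl -mulrBl; apply: le_trans xy1.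
by rewrite ler_wpM2r ?ler_norm// ltW.
Qed.

Lemma dyadic_floor_dist n x i : unit_cube x ->
  `|dyadic_point n (dyadic_floor n x) ord0 i - x ord0 i| <= (2 ^+ n)^-1.
Proof.
move=> xU; have := dyadic_floorP n i xU; rewrite mxE.
set p := dyadic_floor n x i => /andP[p1 p2].
have -> : x ord0 i = (x ord0 i * 2 ^+ n) / 2 ^+ n by rewrite mulfK ?gt_eqF.
rewrite -mulrBl normrM (ger0_norm (x := _^-1)) ?invr_ge0 ?(ltW (pow2_gt0 n))//.
rewrite -[leRHS]mul1r ler_wpM2r ?invr_ge0 ?(ltW (pow2_gt0 n))// ler_norml.
by move: p2; rewrite -natr1; lra.
Qed.

Lemma dyadic_floor_cvg x : unit_cube x ->
  dyadic_point n (dyadic_floor n x) @[n --> \oo] --> x.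
Proof.
move=> xU; apply/cvgrPdist_le => e e0; near=> n.
apply: mx_norm_le_coord => [|i]; first exact: ltW.
rewrite !mxE distrC; have := dyadic_floor_dist n i xU; rewrite mxE => /le_trans.
apply; rewrite -exprVn; near: n.
have /cvgr0Pnorm_le/(_ e e0) : geometric 1 (2^-1 : R) n @[n --> \oo] --> 0.
  by apply: cvg_geometric; rewrite ger0_norm; lra.
by apply: filterS => n /=; rewrite mul1r; apply: le_trans; exact: ler_norm.
Unshelve. all: by end_near. Qed.

Variables (y : 'rV[R]_N -> R) (A b : R).
Hypotheses (A0 : 0 <= A) (b0 : 0 < b) (b1 : b < 1).
(** Diagonal moves, with several [e i] true, are included: one application then passes between the
    floors of consecutive levels. *)
Hypothesis y_step : forall n j (e : 'I_N -> bool),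
  (forall i, (j i < 2 ^ n)%N) ->
  `|y (dyadic_point n (fun i => j i + e i)%N) - y (dyadic_point n j)|
    <= A * b ^+ n.

Let yf n x := y (dyadic_point n (dyadic_floor n x)).

Lemma dyadic_point_double n (j : 'I_N -> nat) :
  dyadic_point n.+1 (fun i => (j i).*2) = dyadic_point n j.
Proof.
apply/rowP => i; rewrite !mxE -mul2n natrM exprS.
by field; rewrite gt_eqF.
Qed.

(** Rewritten at level [n.+1], the coarse floor has the doubled indices, and the fine floor is one
    step of [y_step] away from it. *)
Lemma chain_succ n x : unit_cube x -> `|yf n.+1 x - yf n x| <= A * b ^+ n.+1.
Proof.
move=> xU; have /choice[e he] := fun i => dyadic_floor_succ n i xU.
rewrite /yf -(dyadic_point_double n) (_ : dyadic_floor n.+1 x =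
  (fun i => (dyadic_floor n x i).*2 + e i)%N); last exact/funext.
apply: y_step => i; have := dyadic_floor_lt n i xU; rewrite expnS; lia.
Qed.

(* Both floors are reached from their coordinatewise minimum by unit steps. *)
Lemma chain_near n x x' : unit_cube x -> unit_cube x' ->
  `|x - x'| <= (2 ^+ n)^-1 -> `|yf n x - yf n x'| <= 2 * A * b ^+ n.
Proof.
move=> xU x'U xx'.
have xx'i i : `|x ord0 i - x' ord0 i| <= (2 ^+ n)^-1.
  by apply: le_trans xx'; have := coord_le_mx_norm (x - x') i; rewrite !mxE.
pose p := dyadic_floor n x; pose q := dyadic_floor n x'.
have pq i : (p i <= (q i).+1)%N := dyadic_floor_near xU x'U (xx'i i).
have qp i : (q i <= (p i).+1)%N.
  by apply: (dyadic_floor_near x'U xU); rewrite distrC.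
pose m i := minn (p i) (q i).
have mlt i : (m i < 2 ^ n)%N.
  by apply: leq_ltn_trans (geq_minl _ _) _; exact: dyadic_floor_lt.
have hp := y_step (fun i => p i != m i) mlt.
have hq := y_step (fun i => q i != m i) mlt.
rewrite (_ : (fun i => _) = p) in hp; last first.
  by apply/funext => i; move: (pq i) (qp i); rewrite /m; lia.
rewrite (_ : (fun i => _) = q) in hq; last first.
  by apply/funext => i; move: (pq i) (qp i); rewrite /m; lia.
rewrite /yf -/p -/q; move: hp hq.
set u := y (dyadic_point n p); set v := y (dyadic_point n q).
by rewrite !ler_norml; lra.
Qed.

(** This telescopes [chain_succ]. The geometric sum is kept as a difference so that the induction
    closes; a factor [b] is given away at each step. *)
Lemma chain_add n m x : unit_cube x ->
  `|yf (n + m) x - yf n x| <= A / (1 - b) * (b ^+ n - b ^+ (n + m)).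
Proof.
move=> xU; elim: m => [|m ih]; first by rewrite addn0 !subrr normr0 mulr0.
have := chain_succ (n + m) xU; rewrite -addnS.
have : A * b ^+ (n + m.+1) <= A / (1 - b) * (b ^+ (n + m) - b ^+ (n + m.+1)).
  have -> : A / (1 - b) * (b ^+ (n + m) - b ^+ (n + m.+1)) = A * b ^+ (n + m).
    by rewrite addnS exprS; field; rewrite gt_eqF// subr_gt0.
  by rewrite ler_wpM2l// addnS exprS ger_pMl ?exprn_gt0// ltW.
move: ih; rewrite !ler_norml !mulrBr.
set u := yf _ x; set v := yf n x; set w := yf (n + m) x; lra.
Qed.

Lemma chain_limit n x : unit_cube x -> yf k x @[k --> \oo] --> y x ->
  `|y x - yf n x| <= A / (1 - b) * b ^+ n.
Proof.
move=> xU yx.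
have D0 : 0 <= A / (1 - b) by rewrite divr_ge0// subr_ge0 ltW.
have : `|yf k x - yf n x| @[k --> \oo] --> `|y x - yf n x|.
  by apply: cvg_norm; apply: cvgB => //; exact: cvg_cst.
move=> /cvgr_to_le; apply; near=> k.
have nk : (n <= k)%N by near: k; exact: nbhs_infty_ge.
rewrite -(subnKC nk); apply: le_trans (chain_add n _ xU) _.
by rewrite ler_wpM2l// lerBlDl lerDr exprn_ge0// ltW.
Unshelve. all: by end_near. Qed.

(** The path runs through the two floors at level [n]: [chain_near] joins them, and [chain_limit]
    handles each end. *)
Lemma chain_scale n x x' : unit_cube x -> unit_cube x' ->
  yf k x @[k --> \oo] --> y x -> yf k x' @[k --> \oo] --> y x' ->
  `|x - x'| <= (2 ^+ n)^-1 ->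
  `|y x - y x'| <= 2 * (A + A / (1 - b)) * b ^+ n.
Proof.
move=> xU x'U yx yx' xx'.
have := chain_near xU x'U xx'; have := chain_limit n xU yx.
have := chain_limit n x'U yx'; rewrite !ler_norml; lra.
Qed.

End DyadicChaining.
Arguments dyadic_point {R N} n j.
Arguments unit_cube {R N} x.

Lemma dyadic_scale (R : realType) (h : R) : 0 < h <= 1 ->
  exists n, (2 ^+ n.+1)^-1 < h <= (2 ^+ n)^-1.
Proof.
move=> /andP[h0 h1].
have ex : exists n, (2 ^+ n.+1)^-1 < h.
  have /cvgr0Pnorm_lt/(_ h h0)[n _ hn] :
      geometric 1 (2^-1 : R) n @[n --> \oo] --> 0.
    by apply: cvg_geometric; rewrite ger0_norm; lra.
  exists n; rewrite -exprVn; apply: le_lt_trans (hn n.+1 (leqnSn n)).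
  by rewrite /= mul1r ler_norm.
case: (ex_minnP ex) => -[|n] hn nmin; first
  by exists 0%N; rewrite hn expr0 invr1.
exists n.+1; rewrite hn leNgt; apply/negP => /nmin; by rewrite ltnn.
Qed.

Lemma dyadic_chaining_holder (R : realType) (N : nat) (y : 'rV[R]_N -> R)
    (A alpha : R) : 0 <= A -> 0 < alpha ->
  (forall n j (e : 'I_N -> bool), (forall i, (j i < 2 ^ n)%N) ->
    `|y (dyadic_point n (fun i => j i + e i)%N) - y (dyadic_point n j)|
      <= A * (2 `^ (- alpha)) ^+ n) ->
  (forall x, unit_cube x ->
    y (dyadic_point k (dyadic_floor k x)) @[k --> \oo] --> y x) ->
  exists K : R, forall x x', unit_cube x -> unit_cube x' ->
    `|y x - y x'| <= K * `|x - x'| `^ alpha.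
Proof.
move=> A0 alpha0 ystep ycont; set b := 2 `^ (- alpha) in ystep.
have b0 : 0 < b by rewrite powR_gt0.
have b1 : b < 1 by rewrite powR_lt1 ?ltr1n ?oppr_lt0.
have D0 : 0 <= 2 * (A + A / (1 - b)).
  by rewrite mulr_ge0// addr_ge0// divr_ge0// subr_ge0 ltW.
(* The level [n] chosen below satisfies 2^-n < 2 |x - x'|; the factor 2^alpha absorbs this 2. *)
exists (2 * (A + A / (1 - b)) * 2 `^ alpha) => x x' xU x'U.
have [->|xx'] := eqVneq x x'.
  by rewrite !subrr !normr0 mulr_ge0// ?powR_ge0// mulr_ge0// powR_ge0.
have h01 : 0 < `|x - x'| <= 1.
  rewrite normr_gt0 subr_eq0 xx'/=; apply: mx_norm_le_coord => // i.
  by rewrite !mxE ler_norml; move: (xU i) (x'U i); lra.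
have [n /andP[n1 n2]] := dyadic_scale h01.
apply: le_trans
  (chain_scale A0 b0 b1 ystep xU x'U (ycont _ xU) (ycont _ x'U) n2) _.
rewrite -[leRHS]mulrA ler_wpM2l// -powRM//.
have -> : b ^+ n = (2 ^+ n)^-1 `^ alpha.
  rewrite -(powR_invn n (ler0n R 2)) -(powR_mulrn n (ltW b0)) /b.
  by rewrite -!powRrM; congr powR; ring.
apply: ge0_ler_powR; rewrite ?nnegrE ?(ltW alpha0) ?mulr_ge0//.
move: n1; rewrite exprS invfM; lra.
Qed.

(** * Almost sure control of dyadic increments from moments *)

Lemma ae_bounded_geometric_integrals (R : realType) (d : measure_display)
    (T : measurableType d) (P : probability T R) (g : nat -> T -> \bar R)
    (B q : R) : 0 <= B -> 0 < q < 1 ->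
  (forall n, measurable_fun [set: T] (g n)) ->
  (forall n w, (0 <= g n w)%E) ->
  (forall n, (\int[P]_w g n w <= (B * q ^+ n)%:E)%E) ->
  {ae P, forall w, exists2 M : R, 0 <= M & forall n, (g n w <= M%:E)%E}.
Proof.
move=> B0 /andP[q0 q1] mg g0 ig.
(* The sum of the series has integral at most B / (1 - q), hence is finite almost everywhere. It
   dominates each of its nonnegative terms, so its value serves as [M]. *)
have mS : measurable_fun [set: T] (fun w => \sum_(0 <= n <oo) g n w)%E.
  by apply: ge0_emeasurable_sum.
have S0 w : (0 <= \sum_(0 <= n <oo) g n w)%E by exact: nneseries_ge0.
have : P.-integrable [set: T] (fun w => \sum_(0 <= n <oo) g n w)%E.
  apply/integrableP; split => //.
  under eq_integral do rewrite gee0_abs//.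
  rewrite integral_nneseries//.
  apply: (@le_lt_trans _ _ (B / (1 - q))%:E); last exact: ltry.
  apply: lime_le.
    by apply: is_cvg_nneseries => n _ _; exact: integral_ge0.
  apply: nearW => n.
  apply: (@le_trans _ _ (\sum_(0 <= i < n) (B * q ^+ i)%:E)%E).
    exact: lee_sum.
  rewrite sumEFin lee_fin.
  have := congr1 (@^~ n) (geometric_seriesE B (negbT (lt_eqF q1))).
  rewrite /series /= => ->.
  rewrite ler_pM2r ?invr_gt0 ?subr_gt0// ler_piMr// gerBl exprn_ge0// ltW//.
move=> /(integrable_ae measurableT); apply: filterS => w /(_ I) Sfin.
exists (fine (\sum_(0 <= n <oo) g n w)%E); first exact: fine_ge0.
move=> n; rewrite fineK//.
apply: le_trans (nneseries_lim_ge n.+1 (fun k _ _ => g0 k w)).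
by rewrite big_nat_recr//= leeDr// sume_ge0.
Qed.

(** The upper faces are included here because a neighbour index [j i + e i] can equal 2^n. *)
Definition closed_unit_cube {R : realType} {N : nat} : set 'rV[R]_N :=
  [set x | forall i, 0 <= x ord0 i <= 1].

Lemma dyadic_point_closed_unit_cube (R : realType) (N n : nat)
    (j : 'I_N -> nat) : (forall i, (j i <= 2 ^ n)%N) ->
  closed_unit_cube (dyadic_point (R := R) n j).
Proof.
move=> jn i; rewrite mxE divr_ge0//= ler_pdivrMr ?exprn_gt0//.
by rewrite mul1r -natrX ler_nat.
Qed.

(* Summing [|increment|^eta / 2^(-n alpha eta)] over all dyadic levels and all
   [2^(nN)] cells gives an integrable, hence almost surely finite, function. *)
Lemma dyadic_increments_ae (R : realType) (d : measure_display)
    (T : measurableType d) (P : probability T R) (N : nat)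
    (Y : 'rV[R]_N -> T -> R) (C a alpha eta : R) :
  0 <= C -> 0 < eta -> 0 < alpha -> alpha * eta < a ->
  (forall x, closed_unit_cube x -> measurable_fun [set: T] (Y x)) ->
  (forall x y, closed_unit_cube x -> closed_unit_cube y ->
    ('E_P[fun w => (`|Y x w - Y y w| `^ eta)%R]
       <= (C * `|x - y|%R `^ (N%:R + a))%:E)%E) ->
  {ae P, forall w, exists2 A : R, 0 <= A &
    forall n j (e : 'I_N -> bool), (forall i, (j i < 2 ^ n)%N) ->
    `|Y (dyadic_point n (fun i => j i + e i)%N) w - Y (dyadic_point n j) w|
      <= A * (2 `^ (- alpha)) ^+ n}.
Proof.
move=> C0 eta0 alpha0 alphaa mY momY.
(* Cells and offsets are encoded in a finite type so that each level is a finite sum; the functions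
   [j] and [e] are encoded back at the end. *)
pose I n := ({ffun 'I_N -> 'I_(2 ^ n)} * {ffun 'I_N -> bool})%type.
pose lo n (p : I n) : 'rV[R]_N := dyadic_point n (fun i => p.1 i : nat).
pose hi n (p : I n) : 'rV[R]_N := dyadic_point n (fun i => p.1 i + p.2 i)%N.
have loC n (p : I n) : closed_unit_cube (lo n p).
  by apply: dyadic_point_closed_unit_cube => i; exact: ltnW.
have hiC n (p : I n) : closed_unit_cube (hi n p).
  apply: dyadic_point_closed_unit_cube => i.
  by have := ltn_ord (p.1 i); case: (p.2 i); lia.
pose c : R := 2 `^ (alpha * eta).
have c0 : 0 < c by rewrite powR_gt0.
pose h n (p : I n) w := ((`|Y (hi n p) w - Y (lo n p) w| `^ eta)%:E)%E.
pose F n (p : I n) w := ((c ^+ n)%:E * h n p w)%E.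
pose g n w := (\sum_p F n p w)%E.
have h0 n p w : (0 <= h n p w)%E by rewrite lee_fin powR_ge0.
have mh n p : measurable_fun [set: T] (h n p).
  apply/measurable_EFinP.
  apply: (measurableT_comp (measurable_powR eta)).
  apply: measurableT_comp; first exact: normr_measurable.
  by apply: measurable_funB; exact: mY.
have F0 n p w : (0 <= F n p w)%E by rewrite mule_ge0// lee_fin exprn_ge0// ltW.
have mF n p : measurable_fun [set: T] (F n p).
  exact: measurable_funeM.
have g0 n w : (0 <= g n w)%E by exact: sume_ge0.
have mg n : measurable_fun [set: T] (g n) by exact: emeasurable_sum.
have iF n p : (\int[P]_w F n p w <=
    (c ^+ n * (C * ((2 ^+ n)^-1 `^ (N%:R + a))))%:E)%E.
  rewrite ge0_integralZl_EFin ?exprn_ge0 ?(ltW c0)//.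
  rewrite EFinM lee_wpmul2l ?lee_fin ?exprn_ge0 ?(ltW c0)//.
  have := momY _ _ (hiC n p) (loC n p); rewrite unlock => /le_trans; apply.
  rewrite lee_fin ler_wpM2l//; apply: ge0_ler_powR.
  - rewrite addr_ge0//; apply: ltW; apply: le_lt_trans alphaa.
    by rewrite mulr_ge0 ?ltW.
  - by rewrite nnegrE.
  - by rewrite nnegrE invr_ge0 exprn_ge0.
  apply: mx_norm_le_coord => [|i]; first by rewrite invr_ge0 exprn_ge0.
  rewrite !mxE natrD mulrDl addrAC subrr add0r ger0_norm; last first.
    by rewrite divr_ge0// exprn_ge0.
  by rewrite ler_piMl// ?invr_ge0 ?exprn_ge0// lern1 leq_b1.
(* The 2^(nN) cells cancel the N in the moment exponent N + a. With the weight c^n, level [n] is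
   left with 2^(n(alpha eta - a)) = q^n, times 2^N for the offsets. *)
pose q : R := 2 `^ (alpha * eta - a).
have q01 : 0 < q < 1.
  by rewrite powR_gt0//= powR_lt1 ?ltr1n ?subr_lt0.
have ig n : (\int[P]_w g n w <= (2 ^+ N * C * q ^+ n)%:E)%E.
  rewrite ge0_integral_sum//.
  apply: (le_trans (lee_sum _ (fun p _ => iF n p))).
  have cardI : #|{: I n}|%:R = (2 ^+ n) ^+ N * 2 ^+ N :> R.
    by rewrite card_prod !card_ffun card_bool !card_ord natrM !natrX.
  rewrite sumEFin lee_fin big_const iter_addr_0 -[leLHS]mulr_natr cardI.
  rewrite -exprM -powR_invn// -!powR_mulrn ?(ltW c0) ?powR_ge0//.
  rewrite /c /q -!powRrM natrM -[leLHS]mulrA.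
  have -> : 2 `^ ((alpha * eta - a) * n%:R) = 2 `^ (alpha * eta * n%:R) *
      (2 `^ (- n%:R * (N%:R + a)) * 2 `^ (n%:R * N%:R)) :> R.
    rewrite -!powRD ?pnatr_eq0 ?implybT//; congr powR; ring.
  by rewrite le_eqVlt; apply/orP; left; apply/eqP; ring.
have B0 : 0 <= 2 ^+ N * C by rewrite mulr_ge0// exprn_ge0.
have := ae_bounded_geometric_integrals B0 q01 mg g0 ig.
apply: filterS => w [M M0 gM]; exists (M `^ eta^-1); first exact: powR_ge0.
move=> n j e jn.
pose p : I n := ([ffun i => Ordinal (jn i)], [ffun i => e i]).
have -> : dyadic_point n j = lo n p.
  by apply/rowP => i; rewrite !mxE ffunE.
have -> : dyadic_point n (fun i => j i + e i)%N = hi n p.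
  by apply/rowP => i; rewrite !mxE !ffunE.
set D := `|_|.
have FM : c ^+ n * D `^ eta <= M.
  rewrite -lee_fin EFinM; apply: le_trans (gM n).
  by rewrite /g (bigD1 p)//= leeDl// sume_ge0.
have -> : D = (D `^ eta) `^ eta^-1.
  by rewrite -powRrM divff ?gt_eqF// powRr1 /D.
have -> : (2 `^ (- alpha)) ^+ n = (c ^- n) `^ eta^-1.
  rewrite -(powR_invn n (ltW c0)) -(powR_mulrn n (powR_ge0 2 (- alpha))) /c.
  rewrite -!powRrM.
  by congr powR; field; rewrite gt_eqF.
rewrite -powRM// ?invr_ge0 ?exprn_ge0 ?(ltW c0)//.
apply: ge0_ler_powR; rewrite ?nnegrE ?invr_ge0 ?(ltW eta0) ?powR_ge0//.
  by rewrite mulr_ge0// invr_ge0 exprn_ge0// ltW.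
by rewrite ler_pdivlMr ?exprn_gt0// mulrC.
Qed.

(** * The Kolmogorov criterion on a cube of the orthant *)

Definition cube {R : realType} {N : nat} (o : 'rV[R]_N) (L : R) :
    set 'rV[R]_N :=
  [set t | forall i, o ord0 i <= t ord0 i < o ord0 i + L].

Definition closed_cube {R : realType} {N : nat} (o : 'rV[R]_N) (L : R) :
    set 'rV[R]_N :=
  [set t | forall i, o ord0 i <= t ord0 i <= o ord0 i + L].

Lemma orthant_closed_cube (R : realType) (N : nat) (o t : 'rV[R]_N) (L : R) :
  orthant o -> closed_cube o L t -> orthant t.
Proof. by move=> o0 tC i; have /andP[+ _] := tC i; apply: le_trans. Qed.

Lemma within_continuous_cvg (R : realType) (N : nat) (A : set 'rV[R]_N)
    (f : 'rV[R]_N -> R) (u : nat -> 'rV[R]_N) (l : 'rV[R]_N) :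
  {within A, continuous f} -> A l -> (forall n, A (u n)) ->
  u n @[n --> \oo] --> l -> f (u n) @[n --> \oo] --> f l.
Proof.
move=> /subspace_continuousP fA Al Au ul.
apply: (@cvg_comp _ _ _ u f \oo (within A (nbhs l))); last exact: fA.
move=> U /ul ulU; have uA : (u n @[n --> \oo]) A.
  by exists 0%N => // n _; exact: Au.
by apply: filterS2 uA ulU => x Ax xAU; exact: xAU.
Qed.

Lemma kolmogorov_cube (R : realType) (d : measure_display)
    (T : measurableType d) (P : probability T R) (N : nat)
    (X : 'rV[R]_N -> T -> R) (C a alpha eta : R) (o : 'rV[R]_N) (L : R) :
  0 <= C -> 0 < eta -> 0 < alpha -> alpha * eta < a -> orthant o -> 0 < L ->
  (forall t, orthant t -> measurable_fun [set: T] (X t)) ->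
  {ae P, forall w, {within @orthant R N, continuous (X ^~ w)}} ->
  (forall t u, closed_cube o L t -> closed_cube o L u ->
    ('E_P[fun w => (`|X t w - X u w| `^ eta)%R]
       <= (C * `|t - u|%R `^ (N%:R + a))%:E)%E) ->
  {ae P, forall w, exists K : R, forall t u, cube o L t -> cube o L u ->
    `|X t w - X u w| <= K * `|t - u| `^ alpha}.
Proof.
move=> C0 eta0 alpha0 alphaa o0 L0 mX cX momX.
(* The affine map [phi] transports the problem to the unit cube; the constants change only by powers
   of [L]. *)
pose phi (x : 'rV[R]_N) : 'rV[R]_N := o + L *: x.
pose Y x w := X (phi x) w.
have phiC x : closed_unit_cube x -> closed_cube o L (phi x).
  by move=> xU i; have := xU i; rewrite !mxE lerDl lerD2l; nra.
have phiB x y : phi x - phi y = L *: (x - y).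
  by rewrite /phi opprD addrACA subrr add0r scalerBr.
have mY x : closed_unit_cube x -> measurable_fun [set: T] (Y x).
  by move=> /phiC/(orthant_closed_cube o0) /mX.
have momY x y : closed_unit_cube x -> closed_unit_cube y ->
    ('E_P[fun w => (`|Y x w - Y y w| `^ eta)%R]
       <= (C * L `^ (N%:R + a) * `|x - y|%R `^ (N%:R + a))%:E)%E.
  move=> /phiC xC /phiC yC; have := momX _ _ xC yC.
  by rewrite phiB normrZ (gtr0_norm L0) powRM ?(ltW L0)// mulrA.
have CL0 : 0 <= C * L `^ (N%:R + a) by rewrite mulr_ge0 ?powR_ge0.
have step := dyadic_increments_ae
  CL0 eta0 alpha0 alphaa mY momY.
move: cX; apply: filterS2 step => w [A A0 wstep] wcont.
have ycont x : unit_cube x ->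
    Y (dyadic_point k (dyadic_floor k x)) w @[k --> \oo] --> Y x w.
  move=> xU; apply: (within_continuous_cvg (f := X ^~ w)
    (u := fun k => phi (dyadic_point k (dyadic_floor k x))) wcont).
  - apply: (orthant_closed_cube o0); apply: phiC => i.
    by have /andP[-> /ltW ->] := xU i.
  (* Continuity holds only relative to the orthant, so the approximating dyadic points have to stay
     in it. *)
  - move=> k; apply: (orthant_closed_cube o0); apply: phiC.
    apply: dyadic_point_closed_unit_cube => i; apply: ltnW.
    exact: dyadic_floor_lt.
  - apply: cvgD; first exact: cvg_cst.
    by apply: cvgZl_tmp; exact: dyadic_floor_cvg.
have [K hK] := dyadic_chaining_holder (y := Y ^~ w) A0 alpha0 wstep ycont.
pose psi (t : 'rV[R]_N) : 'rV[R]_N := L^-1 *: (t - o).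
have psiK t : phi (psi t) = t.
  by rewrite /phi /psi scalerA divff ?gt_eqF// scale1r addrC subrK.
have psiU t : cube o L t -> unit_cube (psi t).
  move=> tC i; have := tC i; rewrite !mxE => /andP[t0 t1].
  rewrite mulr_ge0 ?invr_ge0 ?(ltW L0) ?subr_ge0//= mulrC.
  by rewrite ltr_pdivrMr// mul1r ltrBlDl.
exists (K / L `^ alpha) => t u tC uC.
have := hK _ _ (psiU _ tC) (psiU _ uC); rewrite /Y !psiK.
rewrite -mulrA => /le_trans; apply.
have -> : psi t - psi u = L^-1 *: (t - u).
  by rewrite /psi -scalerBr opprB addrA subrK.
rewrite normrZ gtr0_norm ?invr_gt0// powRM ?invr_ge0 ?(ltW L0)//.
by rewrite -powR_inv1 ?(ltW L0)// -powRrM mulN1r powRN.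
Qed.

(** * From fixed cubes to all points simultaneously *)

Lemma ae_forall_count (R : realType) (d : measure_display)
    (T : measurableType d) (P : probability T R) (I : countType)
    (Q : I -> T -> Prop) :
  (forall i, {ae P, forall w, Q i w}) -> {ae P, forall w, forall i, Q i w}.
Proof.
move=> hQ.
(* Integers that encode no index receive the trivial event. *)
have : {ae P, forall w, forall n, if unpickle n is Some i then Q i w else True}.
  apply: ae_foralln => n; case: (unpickle n) => [i|]; first exact: hQ.
  exact: aeW.
by apply: filterS => w h i; have := h (pickle i); rewrite pickleK.
Qed.

(** With h = 2^-k, the corner is taken one grid step below the floor of [t0], and the side is 4h.
    Then [t0] is at least h away from each lower face not on the boundary of the orthant and more
    than 2h away from each upper face, so [delta] = h works. *)
Lemma dyadic_cube_cover (R : realType) (N : nat) (t0 : 'rV[R]_N) (eps : R) :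
  orthant t0 -> 0 < eps ->
  exists (k : nat) (c : {ffun 'I_N -> nat}),
    (forall t, closed_cube (dyadic_point k c) (4 / 2 ^+ k) t ->
      `|t - t0| < eps) /\
    (exists2 delta : R, 0 < delta & forall t, orthant t ->
      `|t - t0| < delta -> cube (dyadic_point k c) (4 / 2 ^+ k) t).
Proof.
move=> t00 eps0.
(* The quotient by 4 makes the side 4h smaller than [eps]; the minimum with 1 meets the range of
   [dyadic_scale]. *)
have h01 : 0 < Num.min 1 (eps / 4) <= 1.
  by rewrite lt_min ltr01 divr_gt0//= ge_min lexx.
have [n /andP[hn _]] := dyadic_scale h01.
move: hn; rewrite lt_min => /andP[_ hn].
set k := n.+1 in hn; pose h : R := (2 ^+ k)^-1.
have h0 : 0 < h by rewrite invr_gt0 exprn_gt0.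
(* The predecessor of 0 is 0: in that case the lower face lies on the boundary of the orthant, where
   no margin is required. *)
exists k, [ffun i => (Num.truncn (t0 ord0 i * 2 ^+ k)).-1].
set c := finfun _.
have oE i : dyadic_point k c ord0 i = (c i)%:R * h by rewrite mxE.
have t0E i : t0 ord0 i * 2 ^+ k * h = t0 ord0 i.
  by rewrite /h mulfK// gt_eqF ?exprn_gt0.
have [lo hi] : (forall i, c i = 0%N \/ (c i).+1%:R * h <= t0 ord0 i) /\
               (forall i, t0 ord0 i < (c i)%:R * h + 2 * h).
  have tr i := truncn_itv (mulr_ge0 (t00 i) (ltW (exprn_gt0 k (ltr0Sn R 1)))).
  split=> i; have := tr i; rewrite /c ffunE;
    case: Num.truncn => [|m] /andP[m1 m2] /=.
  - by left.
  - by right; rewrite -(t0E i) ler_wpM2r// ltW.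
  - rewrite -(t0E i) mul0r add0r ltr_pM2r//; apply: lt_trans m2 _.
    by rewrite ltr_nat.
  - by rewrite -(t0E i) -mulrDl ltr_pM2r// -natrD addn2.
have cle i : (c i)%:R * h <= t0 ord0 i.
  case: (lo i) => [->|]; first by rewrite mul0r.
  by apply: le_trans; rewrite ler_wpM2r ?ler_nat// ltW.
split.
  move=> t tC; apply: (@le_lt_trans _ _ (4 * h)).
    apply: mx_norm_le_coord => [|i]; first by rewrite mulr_ge0// ltW.
    have := tC i; rewrite oE !mxE ler_norml.
    by move: (cle i) (hi i); rewrite -/h; lra.
  by move: hn; rewrite -/h; lra.
exists h => // t t_ge0 tt0 i; rewrite oE -/h.
have : `|t ord0 i - t0 ord0 i| < h.
  by apply: le_lt_trans tt0; have := coord_le_mx_norm (t - t0) i; rewrite !mxE.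
rewrite ltr_norml => tt0i; apply/andP; split; last first.
  by move: (hi i) tt0i; lra.
case: (lo i) => [->|]; first by rewrite mul0r.
by move: tt0i; rewrite -natr1; lra.
Qed.

Lemma ae_local_holder (R : realType) (d : measure_display)
    (T : measurableType d) (P : probability T R) (N : nat)
    (nrm : 'rV[R]_N -> R) (hnrm : is_norm nrm) (X : 'rV[R]_N -> T -> R)
    (eta : R) (mu : 'rV[R]_N -> R) :
  0 < eta -> (forall t, orthant t -> 0 < mu t) ->
  (forall t, orthant t -> measurable_fun [set: T] (X t)) ->
  {ae P, forall w, {within @orthant R N, continuous (X ^~ w)}} ->
  (forall t0, orthant t0 ->
     exists C0 rho0 : R, [/\ 0 < C0, 0 < rho0 &
       forall t u, orthant_ball nrm t0 rho0 t -> orthant_ball nrm t0 rho0 u ->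
         ('E_P[fun w => (`|X t w - X u w| `^ eta)%R]
            <= (C0 * nrm (t - u)%R `^ (N%:R + mu t0))%:E)%E]) ->
  {ae P, forall w, forall t0, orthant t0 -> forall q : rat,
    0 < ratr q :> R -> ratr q < mu t0 / eta ->
    exists K rho : R, [/\ 0 <= K, 0 < rho &
      forall t u, orthant_ball nrm t0 rho t -> orthant_ball nrm t0 rho u ->
        `|X t w - X u w| <= K * nrm (t - u) `^ ratr q]}.
Proof.
move=> eta0 mu0 mX cX momX.
have [K1 K10 nrm_le] := is_norm_le_mx_norm hnrm.
have [K2 K20 le_nrm] := mx_norm_le_is_norm hnrm.
pose I := (nat * {ffun 'I_N -> nat} * rat)%type.
pose o (i : I) : 'rV[R]_N := dyadic_point i.1.1 i.1.2.
pose L (i : I) : R := 4 / 2 ^+ i.1.1.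
have L0 i : 0 < L i by rewrite divr_gt0// exprn_gt0.
have o0 i : orthant (o i) by move=> k; rewrite mxE divr_ge0// exprn_ge0.
(* The real numbers [C] and [a] are quantified inside [good], so the index set stays countable.
   Indices that are not good contribute no condition. *)
pose good (i : I) := 0 < ratr i.2 :> R /\ exists C a : R,
  [/\ 0 <= C, ratr i.2 * eta < a & forall t u, closed_cube (o i) (L i) t ->
    closed_cube (o i) (L i) u -> ('E_P[fun w => (`|X t w - X u w| `^ eta)%R]
       <= (C * `|t - u|%R `^ (N%:R + a))%:E)%E].
have : {ae P, forall w, forall i, good i -> exists K : R, forall t u,
    cube (o i) (L i) t -> cube (o i) (L i) u ->
    `|X t w - X u w| <= K * `|t - u| `^ ratr i.2}.
  apply: ae_forall_count => i.
  have [[q0 [C [a [C0 qa mom]]]]|ng] := pselect (good i); last exact: aeW.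
  have := kolmogorov_cube C0 eta0 q0 qa (o0 i) (L0 i) mX cX mom.
  by apply: filterS.
apply: filterS => w hw t0 t00 q q0 qmu.
have [C0 [rho0 [C00 rho00 mom]]] := momX _ t00.
(* Since [nrm] is at most [K1] times the sup norm, a cube within sup distance rho0 / K1 of [t0] lies
   in the ball where the moment bound holds. *)
have [k [c [sub [delta delta0 sup]]]] :=
  dyadic_cube_cover t00 (divr_gt0 rho00 K10).
pose i : I := (k, c, q).
have Nmu : 0 <= N%:R + mu t0 by rewrite addr_ge0// ltW// mu0.
have gi : good i.
  split=> //; exists (C0 * K1 `^ (N%:R + mu t0)), (mu t0); split.
  - by rewrite mulr_ge0 ?powR_ge0// ltW.
  - by rewrite -ltr_pdivlMr.
  have inball t : closed_cube (o i) (L i) t -> orthant_ball nrm t0 rho0 t.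
    move=> tC; split; first exact: orthant_closed_cube tC.
    apply: le_lt_trans (nrm_le _) _; rewrite mulrC -ltr_pdivlMr//; exact: sub.
  move=> t u /inball tB /inball uB; apply: le_trans (mom _ _ tB uB) _.
  rewrite lee_fin -mulrA -powRM ?(ltW K10)// ler_wpM2l ?(ltW C00)//.
  apply: ge0_ler_powR; rewrite ?nnegrE ?is_norm_ge0 ?mulr_ge0 ?(ltW K10)//.
have [K hK] := hw i gi.
(* The sign of [K] is unknown, hence the absolute value; [K2] converts the sup norm back to [nrm],
   both in the constant and in the radius. *)
exists (`|K| * K2 `^ ratr q), (delta / K2); split.
- by rewrite mulr_ge0 ?powR_ge0.
- exact: divr_gt0.
have incube t : orthant_ball nrm t0 (delta / K2) t -> cube (o i) (L i) t.
  move=> [t_ge0 tB]; apply: sup => //; apply: le_lt_trans (le_nrm _) _.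
  by rewrite mulrC -ltr_pdivlMr.
move=> t u /incube tC /incube uC; apply: le_trans (hK _ _ tC uC) _.
rewrite -mulrA -powRM ?is_norm_ge0 ?(ltW K20)//.
apply: (@le_trans _ _ (`|K| * `|t - u| `^ ratr q)).
  by rewrite ler_wpM2r ?powR_ge0 ?ler_norm.
rewrite ler_wpM2l//; apply: ge0_ler_powR; rewrite ?nnegrE ?(ltW q0)//.
by rewrite mulr_ge0 ?(ltW K20)// is_norm_ge0.
Qed.

(** * From pathwise Hölder bounds to the exponents *)

Lemma limf_esup_at_right_lt_pinfty (R : realType) (f : R -> \bar R)
    (K rho : R) :
  0 < rho -> (forall r, 0 < r < rho -> (f r <= K%:E)%E) ->
  (limf_esup f 0^'+ < +oo)%E.
Proof.
move=> rho0 fK; apply: (@le_lt_trans _ _ K%:E); last exact: ltry.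
(* [limf_esup] is an infimum over the sets of the filter, and the interval from 0 to [rho] is one of
   them. *)
apply: (@le_trans _ _ (ereal_sup (f @` [set r | 0 < r < rho]))).
  apply: ereal_inf_lbound; exists [set r | 0 < r < rho] => //.
  near=> r; apply/andP; split; near: r.
    exact: nbhs_right_gt.
  exact: nbhs_right_lt.
by apply: ge_ereal_sup => _ [r r_itv <-]; exact: fK.
Unshelve. all: by end_near. Qed.

Section LocalHolder.
Variables (R : realType) (N : nat) (nrm : 'rV[R]_N -> R).
Hypothesis hnrm : is_norm nrm.
Variables (x : 'rV[R]_N -> R) (t0 : 'rV[R]_N) (alpha K rho : R).
Hypotheses (K_ge0 : 0 <= K) (rho_gt0 : 0 < rho).
Hypothesis x_holder : forall t u, orthant_ball nrm t0 rho t ->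
  orthant_ball nrm t0 rho u -> `|x t - x u| <= K * nrm (t - u) `^ alpha.

Let orthant_ballW r : r < rho ->
  orthant_ball nrm t0 r `<=` orthant_ball nrm t0 rho.
Proof. by move=> r_rho t [t_ge0 tr]; split=> //; apply: lt_trans r_rho. Qed.

Lemma le_local_holder_exponent : (alpha%:E <= local_holder_exponent nrm x t0)%E.
Proof.
apply: ereal_sup_ubound; exists alpha => //=.
apply: (limf_esup_at_right_lt_pinfty (K := K) rho_gt0) => r /andP[r0 r_rho].
apply: ge_ereal_sup => _ [[t u] [/= tB uB tu] <-].
rewrite lee_fin ler_pdivrMr; last first.
  by rewrite powR_gt0// is_norm_gt0// subr_eq0.
by apply: x_holder; exact: (orthant_ballW r_rho).
Qed.

Lemma le_frontier_2ml s' : s' < 0 ->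
  ((s' + alpha)%:E <= frontier_2ml nrm x t0 s')%E.
Proof.
move=> s'0; apply: ereal_sup_ubound; exists (s' + alpha) => //=.
apply: (limf_esup_at_right_lt_pinfty (K := K * 2 `^ (- s')) rho_gt0).
move=> r /andP[r0 r_rho].
apply: ge_ereal_sup => _ [[t u] [/= tB uB tu] <-].
have tu0 : 0 < nrm (t - u) by rewrite is_norm_gt0// subr_eq0.
rewrite lee_fin ler_pdivrMr; last by rewrite mulr_gt0// powR_gt0.
apply: le_trans (x_holder (orthant_ballW r_rho tB) (orthant_ballW r_rho uB)) _.
rewrite -mulrA ler_wpM2l// mulrCA -powRM ?(ltW r0)//.
(* The factor with exponent [- s'], which is positive, is bounded by (2r)^(-s'). The other factor is
   exactly the one in the denominator, so the sign of s' + alpha is irrelevant. *)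
have -> : nrm (t - u) `^ alpha =
    nrm (t - u) `^ (s' + alpha) * nrm (t - u) `^ (- s').
  rewrite -powRD; last by rewrite (gt_eqF tu0) implybT.
  by congr powR; ring.
rewrite ler_wpM2l ?powR_ge0//; apply: ge0_ler_powR; rewrite ?nnegrE.
- by rewrite oppr_ge0 ltW.
- exact: ltW.
- by rewrite mulr_ge0// ltW.
case: tB uB => _ tr [_ ur].
rewrite (_ : t - u = (t - t0) + - (u - t0)); last by rewrite opprB addrA subrK.
apply: le_trans (is_norm_triangle hnrm _ _) _; rewrite is_normN//.
by move: tr ur; lra.
Qed.

End LocalHolder.

(** Each infimum is at most the value at the centre, which lies in the ball. Monotonicity in the
    radius gives the convergence without which [lim] would be a default value. *)
Lemma liminf_at_le (R : realType) (N : nat) (nrm : 'rV[R]_N -> R)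
    (hnrm : is_norm nrm) (f : 'rV[R]_N -> R) (t0 : 'rV[R]_N) :
  orthant t0 -> (liminf_at nrm f t0 <= (f t0)%:E)%E.
Proof.
move=> t00; pose F r := ereal_inf [set (f u)%:E | u in orthant_ball nrm t0 r].
have Fcvg : cvg (F r @[r --> 0^'+]).
  apply/cvg_ex; eexists.
  apply: (@nonincreasing_at_right_cvge _ F 0 +oo%O) => // r s _ _ rs.
  apply: ereal_inf_le_tmp; apply: image_subset => t [t_ge0 tr]; split=> //.
  exact: lt_le_trans rs.
apply: (lime_le Fcvg); near=> r; apply: ereal_inf_lbound; exists t0 => //.
split=> //; rewrite subrr is_norm0//; near: r; exact: nbhs_right_gt.
Unshelve. all: by end_near. Qed.

Lemma lee_rat_approx (R : realType) (c : R) (y : \bar R) : 0 < c ->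
  (forall q : rat, 0 < ratr q :> R -> ratr q < c -> ((ratr q)%:E <= y)%E) ->
  (c%:E <= y)%E.
Proof.
move=> c0 h; apply/lee_addgt0Pr => e e0.
(* The maximum with 0 makes the rational number found positive as well as within [e] of [c]. *)
have : Num.max 0 (c - e) < c by rewrite gt_max c0 gtrBl.
move=> /rat_in_itvoo[q]; rewrite in_itv/= gt_max => /andP[/andP[q0 qe] qc].
apply: (@le_trans _ _ ((ratr q)%:E + e%:E)%E).
  by rewrite -EFinD lee_fin; lra.
by rewrite leeD2r// h.
Qed.

Unset Implicit Arguments.

Theorem proposition3p5 (R : realType) (d : measure_display)
    (T : measurableType d) (P : probability T R)
    (N : nat) (hN : (1 <= N)%N)
    (nrm : 'rV[R]_N -> R) (hnrm : is_norm nrm)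
    (X : 'rV[R]_N -> T -> R)
    (X_rv : forall t, orthant t -> measurable_fun [set: T] (X t))
    (X_cont : {ae P, forall w, {within @orthant R N, continuous (X ^~ w)}})
    (X_front : forall t0, orthant t0 ->
       {ae P, forall w, graph_meets_D nrm (X ^~ w) t0})
    (eta : R) (eta_gt0 : 0 < eta)
    (mu : 'rV[R]_N -> R) (mu_gt0 : forall t, orthant t -> 0 < mu t)
    (mu_lb : exists2 m : R, 0 < m & forall t, orthant t -> m <= mu t)
    (X_moment : forall t0, orthant t0 ->
       exists C0 rho0 : R, [/\ 0 < C0, 0 < rho0 &
         forall t u, orthant_ball nrm t0 rho0 t -> orthant_ball nrm t0 rho0 u ->
           ('E_P[fun w => (`|X t w - X u w| `^ eta)%R]
              <= (C0 * nrm (t - u)%R `^ (N%:R + mu t0))%:E)%E]) :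
  {ae P, forall w, forall t0, orthant t0 ->
     (liminf_at nrm (fun u => mu u / eta)%R t0
        <= local_holder_exponent nrm (X ^~ w) t0)%E} /\
  {ae P, forall w, forall t0, orthant t0 -> forall s' : R, s' < 0 ->
     (s'%:E + liminf_at nrm (fun u => mu u / eta)%R t0
        <= frontier_2ml nrm (X ^~ w) t0 s')%E}.
Proof.
have holder := ae_local_holder hnrm eta_gt0 mu_gt0 X_rv X_cont X_moment.
have mu_eta_gt0 t : orthant t -> 0 < mu t / eta.
  by move=> t_ge0; rewrite divr_gt0// mu_gt0.
(* Both bounds are read off the same almost sure Hölder estimates. *)
split; apply: filterS holder => w hw t0 t0_ge0.
  apply: le_trans (liminf_at_le hnrm _ t0_ge0) _.
  apply: lee_rat_approx => [|q q0 qmu]; first exact: mu_eta_gt0.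
  have [K [rho [K0 rho0 hK]]] := hw t0 t0_ge0 q q0 qmu.
  exact: (le_local_holder_exponent hnrm rho0 hK).
move=> s' s'0.
apply: le_trans (leeD (lexx s'%:E) (liminf_at_le hnrm _ t0_ge0)) _.
(* Moving [s'] to the right leaves a bare real on the left, the form that [lee_rat_approx]
   approximates by rational numbers. *)
rewrite addeC -leeBrDr//.
apply: lee_rat_approx => [|q q0 qmu]; first exact: mu_eta_gt0.
have [K [rho [K0 rho0 hK]]] := hw t0 t0_ge0 q q0 qmu.
rewrite leeBrDr// -EFinD addrC.
exact: (le_frontier_2ml hnrm K0 rho0 hK).
Qed.
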